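(* Let $G=\langle x,y\rangle$ be a metabelian $2$-group of maximal class and of order $|G|=2^m$, where $m\ge 3$. Suppose that the generators are selected such that $x\in G\setminus\chi_2(G)$ if $m\ge 4$, $y\in\chi_2(G)\setminus\gamma_2(G)$, and the relations $$x^2=s_{m-1}^w,\qquad y^2s_2=s_{m-1}^z$$ are satisfied with exponents $0\le w,z\le 1$. Let the maximal normal subgroups of $G$ be ordered by $M_1=\langle y,\gamma_2(G)\rangle$, $M_2=\langle x,\gamma_2(G)\rangle$, and $M_3=\langle xy,\gamma_2(G)\rangle$. Then $M_1=\chi_2(G)$ if $m\ge 4$, and the following statements hold. (1) The kernels of the transfers $\mathrm{V}_i:G/\gamma_2(G)\to M_i/\gamma_2(M_i)$ for $1\le i\le 3$ are given by $$\mathrm{Ker}(\mathrm{V}_1)=\begin{cases}G/\gamma_2(G),&\text{if }m\ge 3,\ w=0,\ z=0,\\ M_1/\gamma_2(G),&\text{if }m\ge 3,\ w=1,\ z=0,\\ M_2/\gamma_2(G),&\text{if }m\ge 4,\ w=0,\ z=1,\end{cases}$$ $$\mathrm{Ker}(\mathrm{V}_2)=\begin{cases}M_2/\gamma_2(G),&\text{if }m=3,\ w=1,\ z=0,\\ M_3/\gamma_2(G),&\text{otherwise},\end{cases}\qquad \mathrm{Ker}(\mathrm{V}_3)=\begin{cases}M_3/\gamma_2(G),&\text{if }m=3,\ w=1,\ z=0,\\ M_2/\gamma_2(G),&\text{otherwise}.\end{cases}$$ (2) The singulets $\varkappa(i)$ of transfer types of $G$ with $1\le i\le 3$ are given by $$\varkappa(1)=\begin{cases}0,&\text{if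 }m\ge 3,\ G=G_0^{(m)}(0,0)=D(2^m),\\ 1,&\text{if }m\ge 3,\ G=G_0^{(m)}(0,1)=Q(2^m),\\ 2,&\text{if }m\ge 4,\ G=G_0^{(m)}(1,0)=S(2^m),\end{cases}$$ $$\varkappa(2)=\begin{cases}2,&\text{if }m=3,\ G=G_0^{(3)}(0,1)=Q(8),\\ 3,&\text{otherwise},\end{cases}\qquad \varkappa(3)=\begin{cases}3,&\text{if }m=3,\ G=G_0^{(3)}(0,1)=Q(8),\\ 2,&\text{otherwise}.\end{cases}$$ (3) The multiplet $\varkappa=(\varkappa(1),\varkappa(2),\varkappa(3))$ of transfer types of $G$ is given by $$\varkappa=\begin{cases}(1,2,3),\ \nu=0,&\text{if }m=3,\ G=G_0^{(3)}(0,1)=Q(8),\\ (0,3,2),\ \nu=1,&\text{if }m\ge 3,\ G=G_0^{(m)}(0,0)=D(2^m),\\ (1,3,2),\ \nu=0,&\text{if }m\ge 4,\ G=G_0^{(m)}(0,1)=Q(2^m),\\ (2,3,2),\ \nu=0,&\text{if }m\ge 4,\ G=G_0^{(m)}(1,0)=S(2^m).\end{cases}$$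
   Context: Conventions: $[a,b]=a^{-1}b^{-1}ab$. The lower central series is $\gamma_1(G)=G$, $\gamma_j(G)=[\gamma_{j-1}(G),G]$ for $j\ge 2$. A $2$-group of order $2^m$ is of maximal class if its nilpotency class is $m-1$; then $G/\gamma_2(G)$ is of type $(2,2)$. Metabelian means that $\gamma_2(G)$ is abelian. $\chi_2(G)=\{g\in G\mid [g,u]\in\gamma_4(G)\text{ for all }u\in\gamma_2(G)\}$; it contains $\gamma_2(G)$ and equals $G$ if and only if $m=3$. Commutators: $s_2=[y,x]$ and $s_j=[s_{j-1},x]$ for $j\ge 3$. $G_0^{(m)}(z,w)$ denotes the representative of an isomorphism class of metabelian $2$-groups of maximal class of order $2^m$ which satisfies $[y,s_2]=1$ and the two relations displayed in the claim with fixed exponents $w$ and $z$ (note the order of the arguments: first $z$, then $w$). $D(2^m)$, $Q(2^m)$ and $S(2^m)$ denote the dihedral, (generalised) quaternion and semi-dihedral group of order $2^m$. $\mathrm{V}_i$ is the usual group theoretic transfer from $G$ to $M_i$. The singulet of transfer type is $\varkappa(i)=0$ if $\mathrm{Ker}(\mathrm{V}_i)=G/\gamma_2(G)$, and $\varkappa(i)=j$ if $\mathrm{Ker}(\mathrm{V}_i)=M_j/\gamma_2(G)$ with $1\le j\le 3$. The number of total transfers is $\nu=\#\{1\le i\le 3\mid\mathrm{Ker}(\mathrm{V}_i)=G/\gamma_2(G)\}$.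
   Formalization: The case m=3, z=1 is excluded: there y^2=1 and G=D(8), and the claim ''Ker(V_2)=M_3/γ_2(G) otherwise'' is false (the kernel is M_1/γ_2(G) for w=0 and G/γ_2(G) for w=1). *)

(* Defs.v *)
From HB Require Import structures.
From mathcomp Require Import all_boot all_algebra all_fingroup all_solvable.

Set Implicit Arguments.
Unset Strict Implicit.
Unset Printing Implicit Defensive.

Local Open Scope group_scope.

(* Here [~ a, b] = a^-1 * b^-1 * a * b, and 'L_j(G) is gamma_j(G).            *)

Section Defs.

Variable gT : finGroupType.
Implicit Types (G M : {group gT}) (x y a : gT).

(* s x y j is s_j for j >= 2; the values at j < 2 are junk (equal to s_2).    *)
Definition s x y (j : nat) : gT := iter (j - 2) (fun u => [~ u, x]) [~ y, x].

Definition chi2 G : {set gT} :=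
  [set g in G | [forall u in 'L_2(G), [~ g, u] \in 'L_4(G)]].

(* The part of "G = G_0^(m)(z,w)" that concerns the chosen generators x, y;   *)
(* that G is metabelian of maximal class and order 2^m is stated separately.  *)
(* Argument order: first z, then w.                                           *)
Definition G0_relations (m z w : nat) x y : Prop :=
  [/\ [~ y, s x y 2] = 1,
      x ^+ 2 = s x y m.-1 ^+ w
    & y ^+ 2 * s x y 2 = s x y m.-1 ^+ z].

Definition maxsub G a : {group gT} := <<a |: 'L_2(G)>>%G.

Section Transfer.

Variables G M : {group gT}.

Definition abelianization : {morphism M >-> coset_of 'L_2(M)} :=
  restrm_morphism (lcn_norm 2 M) (coset_morphism 'L_2(M)).

Lemma abelianization_abelian : abelian (abelianization @* M).
Proof. by rewrite im_restrm; apply: der_abelian 0 M. Qed.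

(* The library's transfer takes values in the image M / 'L_2(M) of            *)
(* abelianization, written additively.                                        *)
Definition transfer_to :
    {morphism G >-> FiniteModule.fmod_of abelianization_abelian} :=
  transfer_morphism G abelianization_abelian.

Definition proj_ab : {morphism G >-> coset_of 'L_2(G)} :=
  restrm_morphism (lcn_norm 2 G) (coset_morphism 'L_2(G)).

Lemma ker_proj_ab_transfer : 'ker proj_ab \subset 'ker transfer_to.
Proof.
rewrite ker_restrm ker_coset (setIidPr (lcn_sub 2 G)).
apply: (der1_min (ker_norm _)).
have /isog_abelian abE := first_isog transfer_to.
by move: abE => /= ->; apply: FinRing.zmod_abelian.
Qed.

(* V : G / 'L_2(G) -> M / 'L_2(M); meaningful only for M a subgroup of G.     *)
Definition V := factm_morphism ker_proj_ab_transfer (subxx G).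

Definition kerV : {set coset_of 'L_2(G)} := 'ker V.

End Transfer.

Section TransferType.

Variables (G M1 M2 M3 : {group gT}).

(* 0 if K = G / 'L_2(G), j if K = M_j / 'L_2(G), and the out-of-range value 4 *)
(* if K is none of these.                                                     *)
Definition singulet (K : {set coset_of 'L_2(G)}) : nat :=
  index K [:: G / 'L_2(G); M1 / 'L_2(G); M2 / 'L_2(G); M3 / 'L_2(G)].

Definition total_transfers (Ks : seq {set coset_of 'L_2(G)}) : nat :=
  count_mem (G / 'L_2(G)) Ks.

End TransferType.

End Defs.

(* Main.v *)
Require Import Defs.
From HB Require Import structures.
From mathcomp Require Import all_boot all_algebra all_fingroup all_solvable.

(* Put k = m - 2. As G has class m - 1, the commutator c = s_(m-1) is central,
   so the relation for y^2 gives y^x = y^-1 c^z, and x inverts s_2. Hence each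
   s_j is a power of s_2, and c = y^(2^k) is an involution. Therefore <y> is
   cyclic of index 2, gamma_2(G) = <y^2> has index 4, and the defining
   relations of D, Q or SD can be read off. The pair (xy, y) satisfies
   relations of the same shape with w + z instead of w, which exchanges M_2
   and M_3. Finally the transfer to a subgroup M of index 2 is g |-> g^2
   outside M and g |-> g g^t on M, for any t outside M; as a transfer kernel
   contains gamma_2(G), it is determined by the values at x, y and xy. *)

Set Implicit Arguments.
Unset Strict Implicit.
Unset Printing Implicit Defensive.

Local Open Scope group_scope.

(** * The transfer to a subgroup of index 2 *)

Section TransferIndex2.

Import FiniteModule GRing.Theory.

Variables (gT : finGroupType) (G M : {group gT}).
Hypotheses (sMG : M \subset G) (iMG : #|G : M| = 2).

(** The class of [u] in M / gamma_2(M), written additively. Outside M the value is a default one, so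
    the rules below ask for membership in M. *)
Let fab u := fmod (abelianization_abelian M) (coset 'L_2(M) u).

Let fabM : {in M &, forall u v, fab (u * v)%g = fab u + fab v}%R.
Proof.
move=> u v Mu Mv; rewrite /fab morphM ?(subsetP (lcn_norm 2 M)) //.
by rewrite fmodM //= im_restrm mem_quotient.
Qed.

Let fab_eq0 u : u \in M -> (fab u == 0%R) = (u \in 'L_2(M)).
Proof.
move=> Mu; rewrite -(inj_eq val_inj) fmodK.
apply/eqP/idP=> [|/coset_id//]; apply: coset_idr.
  exact: (subsetP (lcn_norm 2 M)).
by rewrite /= im_restrm mem_quotient.
Qed.

(** The library sums over the right cosets of M, each with the representative picked by [repr]. For
    any t outside M the cosets are M and Mt; the representative of Mt is known only as some h t with
    h in M. *)
Let transferE g t : t \in G :\: M ->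
  transfer_to G M g =
    (fab (repr (M : {set gT}) * g * (repr (M :* g))^-1)%g +
     fab (repr (M :* t) * g * (repr (M :* t :* g))^-1)%g)%R.
Proof.
move=> MGt; have [Gt nMt] := setDP MGt.
have neM : (M : {set gT}) != M :* t.
  by apply: contra nMt => /eqP ->; apply: rcoset_refl.
have defR : rcosets M G = [set (M : {set gT}); M :* t].
  apply/eqP; rewrite eq_sym eqEcard [#|rcosets M G|]iMG cards2 neM andbT.
  by rewrite subUset !sub1set -{1}(rcoset1 M) -!rcosetE !imset_f.
by rewrite /transfer_to /= /transfer defR big_setU1 ?big_set1 // inE.
Qed.

(** Such a g swaps the two cosets. With h g as the representative of Mg, the two terms are h^-1 and
    h g g, and h cancels. *)
Lemma transfer_index2_out g : g \in G :\: M ->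
  (transfer_to G M g == 0%R) = (g ^+ 2 \in 'L_2(M)).
Proof.
move=> MGg; have [Gg nMg] := setDP MGg.
have Mg2: g * g \in M.
  apply: contraR nMg => nMg2.
  have: g * g \in G :\: M by rewrite inE nMg2 groupM.
  by rewrite -(rcoset_index2 sMG iMG MGg) mem_rcoset mulgK.
rewrite (transferE _ MGg) repr_group mul1g.
rewrite -[M :* g :* g]rcosetM (rcoset_id Mg2) repr_group invg1 mulg1.
case: repr_rcosetP => h Mh.
rewrite -fabM ?mulgA ?fab_eq0 //=.
- by rewrite invMg !mulgA mulgV mul1g mulVg mul1g.
- by rewrite invMg !mulgA mulgV mul1g mulVg mul1g.
- by rewrite invMg mulgA mulgV mul1g groupV.
- by rewrite -mulgA groupM.
Qed.

Lemma transfer_index2_in g t : t \in G :\: M -> g \in M ->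
  (transfer_to G M g == 0%R) = (g * g ^ t \in 'L_2(M)).
Proof.
move=> MGt Mg; have [Gt nMt] := setDP MGt.
(* The second coset is represented through t^-1, so that its term is conjugate to g^t = t^-1 g t. *)
have MGtV : t^-1 \in G :\: M by rewrite inE !groupV nMt.
have Mgt : g ^ t \in M.
  by rewrite memJ_norm // (subsetP (normal_norm (index2_normal sMG iMG))).
rewrite (transferE _ MGtV) repr_group mul1g (rcoset_id Mg) repr_group.
rewrite invg1 mulg1.
have -> : M :* t^-1 :* g = M :* t^-1.
  rewrite -rcosetM; apply/rcoset_eqP; rewrite mem_rcoset invgK.
  by rewrite -mulgA -conjgE.
case: repr_rcosetP => h Mh.
have -> : h * t^-1 * g * (h * t^-1)^-1 = h * (g ^ t * h^-1).
  by rewrite invMg invgK conjgE !mulgA.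
have MgtV : g ^ t * h^-1 \in M by rewrite groupM ?groupV.
(* The unknown h drops out because the values of [fab] commute. *)
have -> : fab (h * (g ^ t * h^-1)) = fab (g ^ t).
  by rewrite fabM // addrC -fabM // mulgKV.
by rewrite -fabM // fab_eq0 // groupM.
Qed.
End TransferIndex2.

(** * Kernels of the induced maps on G / gamma_2(G) *)

Section KernelOfV.

Variables (gT : finGroupType) (G M : {group gT}).

Lemma kerVE : kerV G M = 'ker (transfer_to G M) / 'L_2(G).
Proof.
rewrite /kerV /V ker_factm /= /proj_ab morphim_restrm.
by rewrite (setIidPr _) // subsetIl.
Qed.

Let lcn2_ker : 'L_2(G) \subset 'ker (transfer_to G M).
Proof.
have := ker_proj_ab_transfer G M.
by rewrite ker_restrm ker_coset (setIidPr (lcn_sub 2 G)).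
Qed.

Lemma kerV_full x y : G :=: <<[set x; y]>> -> x \in G -> y \in G ->
    transfer_to G M x == 0%R -> transfer_to G M y == 0%R ->
  kerV G M = G / 'L_2(G).
Proof.
move=> genG Gx Gy Vx Vy; rewrite kerVE; apply: (congr1 (fun A => A / 'L_2(G))).
apply/eqP; rewrite eqEsubset subsetIl /= {1}genG gen_subG subUset !sub1set.
by rewrite !(sameP (kerP _ _) eqP) ?Vx.
Qed.

(** The kernel contains a and gamma_2(G), hence the subgroup they generate; that one is maximal
    because its index is prime, and b keeps the kernel from being G. *)
Lemma kerV_maxsub a b : a \in G -> b \in G -> #|G : maxsub G a| = 2 ->
    transfer_to G M a == 0%R -> transfer_to G M b != 0%R ->
  kerV G M = maxsub G a / 'L_2(G).
Proof.
move=> Ga Gb iaG Va Vb; rewrite kerVE; apply: (congr1 (fun A => A / 'L_2(G))).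
set K := ('ker (transfer_to G M))%G; rewrite -[LHS]/(gval K).
have saK : maxsub G a \subset K.
  by rewrite gen_subG subUset sub1set lcn2_ker (sameP (kerP _ _) eqP) ?Va.
have sKG : K \subset G by apply: subsetIl.
have maxa : maximal_eq (maxsub G a) G.
  by rewrite /maximal_eq p_index_maximal ?iaG ?orbT // (subset_trans saK).
have /maximal_eqP[_ /(_ K saK sKG)[//|eKG]] := maxa.
have /(kerP _ Gb)/eqP : b \in K by rewrite eKG.
by rewrite (negPf Vb).
Qed.

End KernelOfV.

(** * The maximal subgroups above gamma_2(G) *)

Section MaxSub.

Variables (gT : finGroupType) (G : {group gT}).

Lemma lcn2_sub_maxsub a : 'L_2(G) \subset maxsub G a.
Proof. exact: subset_trans (subsetUr _ _) (subset_gen _). Qed.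

Lemma mem_maxsub a : a \in maxsub G a.
Proof. by rewrite mem_gen ?setU11. Qed.

Lemma maxsub_sub a : a \in G -> maxsub G a \subset G.
Proof. by move=> Ga; rewrite gen_subG subUset sub1set Ga lcn_sub. Qed.

Lemma maxsub_mulr a u : u \in 'L_2(G) -> maxsub G (a * u) = maxsub G a.
Proof.
move=> L2u; apply/group_inj/eqP.
rewrite eqEsubset /= !gen_subG !subUset !sub1set !lcn2_sub_maxsub !andbT.
rewrite groupM ?mem_maxsub ?(subsetP (lcn2_sub_maxsub a)) //=.
rewrite -{1}(mulgK u a) groupM ?groupV ?mem_maxsub //.
exact: (subsetP (lcn2_sub_maxsub _)).
Qed.

(** Modulo gamma_2(G), a group of order 4 remains, in which a has order 2. *)
Lemma index_maxsub a : #|G : 'L_2(G)| = 4 -> a \in G -> a \notin 'L_2(G) ->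
  a ^+ 2 \in 'L_2(G) -> #|G : maxsub G a| = 2.
Proof.
move=> iL2 Ga nL2a L2a2.
have nL2 := subsetP (lcn_norm 2 G) a Ga.
have oM : #|maxsub G a / 'L_2(G)| = 2.
  rewrite [maxsub G a : {set gT}](_ : _ = <[a]> <*> 'L_2(G)); last first.
    by rewrite joing_idl.
  rewrite quotientYidr ?cycle_subG // quotient_cycle //.
  apply: nt_prime_order => //; first by rewrite -morphX //= coset_id.
  by apply: contra nL2a => /eqP; apply: coset_idr.
have iM : #|maxsub G a : 'L_2(G)| = 2.
  by rewrite -card_quotient // (subset_trans (maxsub_sub Ga)) ?lcn_norm.
have := Lagrange_index (maxsub_sub Ga) (lcn2_sub_maxsub a).
by rewrite iM iL2 -[4%N]/(2 * 2)%N => /eqP; rewrite eqn_pmul2r // => /eqP.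
Qed.

Lemma notin_maxsub a b : G :=: <<[set a; b]>> -> #|G : maxsub G a| = 2 ->
  b \notin maxsub G a.
Proof.
move=> genG iM; apply/negP => Mb; suff: #|G : maxsub G a| = 1%N by rewrite iM.
by apply/eqP; rewrite indexg_eq1 genG gen_subG subUset !sub1set mem_maxsub.
Qed.

Lemma lcn2_normal_maxsub a : a \in G -> 'L_2(G) <| maxsub G a.
Proof.
move=> Ga; apply: normalS (lcn2_sub_maxsub a) (maxsub_sub Ga) _.
exact: lcn_normal.
Qed.

Lemma maxsub_quo_neqG a : a \in G -> #|G : maxsub G a| = 2 ->
  (G / 'L_2(G) == maxsub G a / 'L_2(G)) = false.
Proof.
move=> Ga iM; apply/negP => /eqP eqQ.
have := quotient_inj (lcn_normal 2 G) (lcn2_normal_maxsub Ga) eqQ.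
by move=> eG; move: iM; rewrite -eG indexgg.
Qed.

Lemma maxsub_quo_neq a b : a \in G -> b \in G -> G :=: <<[set a; b]>> ->
    #|G : maxsub G a| = 2 ->
  (maxsub G a / 'L_2(G) == maxsub G b / 'L_2(G)) = false.
Proof.
move=> Ga Gb genG iM; apply/negP => /eqP eqQ.
have eM := quotient_inj (lcn2_normal_maxsub Ga) (lcn2_normal_maxsub Gb) eqQ.
by have := notin_maxsub genG iM; rewrite eM mem_maxsub.
Qed.

End MaxSub.

(* The exponent [w] is arbitrary so that the presentation is stable under     *)
(* replacing [x] by [x * y], which turns [w] into [w + z].                    *)
Definition cyclic_index2_pres (gT : finGroupType) (G : {group gT}) k w z x y :=
  let c := y ^+ (2 ^ k) in
  [/\ #|G| = (2 ^ k.+2)%N, #[y] = (2 ^ k.+1)%N, G :=: <<[set x; y]>>,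
      x ^+ 2 = c ^+ w & y ^ x = y^-1 * c ^+ z].

(** * Structure of a group with a cyclic subgroup of index 2 *)

Section Presentation.

Variables (gT : finGroupType) (G : {group gT}) (k w z : nat) (x y : gT).
Hypotheses (k_gt0 : 0 < k) (z_k1 : k = 1%N -> z = 0%N).
Hypothesis presG : cyclic_index2_pres G k w z x y.

Local Notation c := (y ^+ (2 ^ k)).

Let oG : #|G| = (2 ^ k.+2)%N. Proof. by case: presG. Qed.
Let oy : #[y] = (2 ^ k.+1)%N. Proof. by case: presG. Qed.
Let genG : G :=: <<[set x; y]>>. Proof. by case: presG. Qed.
Let x2 : x ^+ 2 = c ^+ w. Proof. by case: presG. Qed.
Let yx : y ^ x = y^-1 * c ^+ z. Proof. by case: presG. Qed.

Let Gx : x \in G. Proof. by rewrite genG mem_gen ?set21. Qed.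
Let Gy : y \in G. Proof. by rewrite genG mem_gen ?set22. Qed.

Let c2 : c ^+ 2 = 1.
Proof. by rewrite -expgM mulnC -expnS -oy expg_order. Qed.

Let ceven n : ~~ odd n -> c ^+ n = 1.
Proof.
by move=> /even_halfK; rewrite -mul2n => <-; rewrite expgM c2 expg1n.
Qed.

Let codd n : odd n -> c ^+ n = c.
Proof.
move=> on; rewrite -(odd_double_half n) on expgD.
by rewrite [c ^+ _.*2]ceven ?odd_double // mulg1.
Qed.

Let c_in_y2 : c \in <[y ^+ 2]>.
Proof. by rewrite -(prednK k_gt0) expnS expgM mem_cycle. Qed.

(** Squaring y^x = y^-1 c^z removes the factor c^z, so even powers of y are inverted whatever z
    is. *)
Let y2x : (y ^+ 2) ^ x = (y ^+ 2)^-1.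
Proof.
rewrite conjXg yx expgMn; last first.
  exact/commuteX/commuteX/commute_sym/commuteV/commute_refl.
by rewrite -expgM mulnC expgM c2 expg1n mulg1 expgVn.
Qed.

(** Used for n = 1 and n = 2, which give gamma_2(G) and gamma_2(M_2). *)
Let normal_pow2 n : <[y ^+ (2 * n)]> <| G.
Proof.
rewrite /normal cycle_subG groupX //= genG gen_subG subUset !sub1set.
rewrite [y \in _](subsetP (cent_sub _)) ?andbT; last first.
  by rewrite cent_cycle; apply/cent1P/commuteX.
by rewrite -cycle_subG norms_cycle expgM conjXg y2x expgVn groupV cycle_id.
Qed.

Let x_notin_y : x \notin <[y]>.
Proof.
apply/negP => yx'; have : G \subset <[y]>.
  by rewrite genG gen_subG subUset !sub1set yx' cycle_id.
by move/subset_leq_card; rewrite oG -orderE oy leq_exp2l // ltnn.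
Qed.

Let order_pow2 i : i <= k.+1 -> #[y ^+ (2 ^ i)] = (2 ^ (k.+1 - i))%N.
Proof.
by move=> le_i; rewrite orderXdiv oy ?dvdn_exp2l // -expnB.
Qed.

(** The quotient by <y^2> has order 4, hence is abelian. Conversely [y, x] = y^-2 c^z, and for k > 1
    its power with exponent 2^(k-1) is c^-1 = c, so that y^-2 can be recovered. *)
Lemma lcn2_pres : 'L_2(G) = <[y ^+ 2]>.
Proof.
apply/eqP; rewrite eqEsubset; apply/andP; split.
  apply: (der1_min (normal_norm (normal_pow2 1))).
  apply: (@card_p2group_abelian _ 2) => //.
  rewrite card_quotient ?(normal_norm (normal_pow2 1)) //.
  rewrite -divgS ?(normal_sub (normal_pow2 1)) // oG -orderE (@order_pow2 1) //.
  by rewrite subSS subn0 -[k.+2]addn2 expnD mulKn ?expn_gt0.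
rewrite cycle_subG -groupV.
pose u := [~ y, x].
have L2u : u \in 'L_2(G) by apply: mem_commg.
have uE : u = (y ^+ 2)^-1 * c ^+ z.
  by rewrite /u commgEl yx mulgA -invMg.
have -> : (y ^+ 2)^-1 = u * c ^+ z.
  by rewrite uE -mulgA -expgD addnn ceven ?odd_double ?mulg1.
rewrite groupM //.
(* For k = 1 one has c = y^2, and z = 1 would give y^x = y and an abelian group; this is what [z_k1]
   excludes. *)
have [k1|k_neq1] := eqVneq k 1%N; first by rewrite z_k1 ?expg0.
rewrite groupX //.
suff -> : c = u ^+ (2 ^ k.-1) by rewrite groupX.
have k1_gt0 : 0 < k.-1 by rewrite -subn1 subn_gt0 ltn_neqAle eq_sym k_neq1.
rewrite uE expgMn; last first.
  exact/commuteX/commuteX/commute_sym/commuteV/commuteX/commute_refl.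
rewrite -expgM [c ^+ _]ceven ?mulg1; last first.
  by rewrite oddM oddX eqn0Ngt k1_gt0 andbF.
rewrite expgVn -expgM -expnS prednK //.
by apply/eqP; rewrite eq_sym eq_invg_mul -c2 expgS expg1.
Qed.

Lemma index_lcn2_pres : #|G : 'L_2(G)| = 4.
Proof.
rewrite -divgS ?lcn_sub //= lcn2_pres oG -orderE (@order_pow2 1) //.
by rewrite subSS subn0 -[k.+2]addn2 expnD mulKn ?expn_gt0.
Qed.

Let cz_y n : y * c ^+ n = c ^+ n * y.
Proof. exact/commuteX/commuteX/commute_refl. Qed.

Let xy2 : (x * y) ^+ 2 = c ^+ (w + z).
Proof.
rewrite expgS expg1 mulgA -(mulgA x y x) (conjgC y) yx mulgA.
by rewrite -[x * x]/(x ^+ 2) x2 -!mulgA -cz_y mulKg expgD.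
Qed.

Lemma pres_mulr : cyclic_index2_pres G k (w + z) z (x * y) y.
Proof.
split=> //; last first.
  by rewrite conjgM yx conjgE -mulgA -cz_y mulKg.
have Gxy : x * y \in G by apply: groupM.
apply/eqP; rewrite eqEsubset {1}genG !gen_subG !subUset !sub1set Gxy Gy !andbT.
rewrite [y \in _]mem_gen ?set22 // andbT -{1}(mulgK y x).
by rewrite groupM ?groupV ?mem_gen ?set21 ?set22.
Qed.

Let y_notin_L2 : y \notin 'L_2(G).
Proof.
rewrite lcn2_pres; apply/negP; rewrite -cycle_subG => /subset_leq_card.
rewrite -!orderE (@order_pow2 1) // oy leqNgt; case/negP.
by rewrite ltn_exp2l // subSS subn0.
Qed.

Let x_notin_L2 : x \notin 'L_2(G).
Proof.
rewrite lcn2_pres; apply: contra x_notin_y; apply/subsetP.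
by rewrite cycle_subG mem_cycle.
Qed.

Lemma index_maxsub_y : #|G : maxsub G y| = 2.
Proof.
by apply: index_maxsub index_lcn2_pres _ _ _; rewrite // lcn2_pres cycle_id.
Qed.

Lemma index_maxsub_x : #|G : maxsub G x| = 2.
Proof.
apply: index_maxsub index_lcn2_pres _ _ _; rewrite // lcn2_pres x2.
by rewrite groupX.
Qed.

Lemma maxsub_y : maxsub G y = <[y]>%G.
Proof.
apply/group_inj/eqP; rewrite eqEsubset /= cycle_subG mem_maxsub andbT.
by rewrite gen_subG subUset sub1set cycle_id lcn2_pres cycle_subG mem_cycle.
Qed.

(** The same pattern one level down: <y^4> has index 4 in M_2, and [y^2, x] = y^-4. For k = 1 both
    sides are trivial. *)
Lemma lcn2_maxsub_x : 'L_2(maxsub G x) = <[y ^+ 4]>.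
Proof.
set M := maxsub G x.
have sMG : M \subset G by apply: maxsub_sub.
have oM : #|M| = (2 ^ k.+1)%N.
  apply/eqP; rewrite -(eqn_pmul2r (isT : 0 < 2)) -{1}index_maxsub_x Lagrange //.
  by rewrite oG expnSr.
have y2M : y ^+ 2 \in M.
  by rewrite (subsetP (lcn2_sub_maxsub G x)) // lcn2_pres cycle_id.
have y4M : y ^+ 4 \in M by rewrite -[4%N]/(2 * 2)%N expgM groupX.
apply/eqP; rewrite eqEsubset; apply/andP; split.
  have nyM : M \subset 'N(<[y ^+ 4]>).
    exact: subset_trans sMG (normal_norm (normal_pow2 2)).
  apply: (der1_min nyM); apply: (@card_p2group_abelian _ 2) => //.
  rewrite card_quotient // -divgS ?cycle_subG // oM -orderE (@order_pow2 2) //.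
  rewrite !subSS -(prednK k_gt0) subSS subn0 -[k.-1.+2]addn2.
  by rewrite expnD mulKn ?expn_gt0.
rewrite cycle_subG -groupV.
have -> : (y ^+ 4)^-1 = [~ y ^+ 2, x].
  by rewrite commgEl y2x -invMg -expgD.
by apply: mem_commg => //; apply: mem_maxsub.
Qed.

(** * The kernels of V_1 and V_2, and chi_2(G) *)

Let c_expg_eq1 n : (c ^+ n == 1) = ~~ odd n.
Proof. by rewrite -order_dvdn (@order_pow2 k) // subSnn dvdn2. Qed.

Let lcn2_maxsub_y : 'L_2(maxsub G y) = 1.
Proof. by rewrite maxsub_y; apply/derG1P/cycle_abelian. Qed.

Let x_out_y : x \in G :\: maxsub G y.
Proof. by rewrite inE maxsub_y x_notin_y. Qed.

Let y_out_x : y \in G :\: maxsub G x.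
Proof. by rewrite inE Gy (notin_maxsub genG index_maxsub_x). Qed.

(** As M_1 = <y> is abelian, V_1 takes the values x^2 = c^w at x and y y^x = c^z at y; the parities
    of w and z decide. *)
Let transfer_y_x : (transfer_to G (maxsub G y) x == 0%R) = ~~ odd w.
Proof.
rewrite transfer_index2_out ?maxsub_sub ?index_maxsub_y // lcn2_maxsub_y.
by rewrite x2 inE c_expg_eq1.
Qed.

Let transfer_y_y : (transfer_to G (maxsub G y) y == 0%R) = ~~ odd z.
Proof.
rewrite (transfer_index2_in _ _ x_out_y) ?mem_maxsub ?maxsub_sub //; last first.
  exact: index_maxsub_y.
by rewrite lcn2_maxsub_y yx mulKVg inE c_expg_eq1.
Qed.

Lemma kerV_y_full : ~~ odd w -> ~~ odd z ->
  kerV G (maxsub G y) = G / 'L_2(G).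
Proof.
by move=> ew ez; apply: (kerV_full genG); rewrite ?transfer_y_x ?transfer_y_y.
Qed.

Lemma kerV_y_y : odd w -> ~~ odd z ->
  kerV G (maxsub G y) = maxsub G y / 'L_2(G).
Proof.
move=> ow ez; apply: (kerV_maxsub (b := x)) index_maxsub_y _ _ => //.
  by rewrite transfer_y_y.
by rewrite transfer_y_x ow.
Qed.

Lemma kerV_y_x : ~~ odd w -> odd z ->
  kerV G (maxsub G y) = maxsub G x / 'L_2(G).
Proof.
move=> ew oz; apply: (kerV_maxsub (b := y)) index_maxsub_x _ _ => //.
  by rewrite transfer_y_x.
by rewrite transfer_y_y oz.
Qed.

(** The value y^2 generates gamma_2(G), which is strictly larger than gamma_2(M_2) = <y^4>; hence
    V_2 is never total. *)
Let transfer_x_y : transfer_to G (maxsub G x) y != 0%R.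
Proof.
rewrite transfer_index2_out ?maxsub_sub ?index_maxsub_x // lcn2_maxsub_x.
apply/negP; rewrite -cycle_subG => /subset_leq_card.
rewrite -!orderE (@order_pow2 1) // (@order_pow2 2) // leq_exp2l //.
by rewrite !subSS subn0 subn1 leqNgt prednK ?leqnn.
Qed.

(** For k = 1 one has z = 0 and c = y^2, so V_2 sends x to x x^y = x^2 y^2 = c^(w+1), which is 1 for
    odd w. *)
Lemma kerV_x_x : k = 1%N -> odd w ->
  kerV G (maxsub G x) = maxsub G x / 'L_2(G).
Proof.
move=> k1 ow; apply: (kerV_maxsub (b := y)) index_maxsub_x _ _ => //.
rewrite (transfer_index2_in _ _ y_out_x) ?mem_maxsub ?maxsub_sub //; last first.
  exact: index_maxsub_x.
have xy : x ^ y = x * y ^+ 2.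
  have yx1 : y ^ x = y^-1 by rewrite yx z_k1 ?mulg1.
  apply: (mulgI y).
  by rewrite -conjgC mulgA (conjgC y) yx1 -mulgA expgS expg1 mulKg.
rewrite xy mulgA -[x * x]/(x ^+ 2) x2.
have -> : y ^+ 2 = c by rewrite k1.
by rewrite -expgSr ceven ?group1 //= negbK.
Qed.

(** V_2 sends xy to (xy)^2 = c^(w+z). For k > 1 this lies in <y^4> because 4 divides 2^k; for k = 1
    it is 1 because z = 0 and w is even. *)
Lemma kerV_x_xy : ~ (k = 1%N /\ odd w) ->
  kerV G (maxsub G x) = maxsub G (x * y) / 'L_2(G).
Proof.
move=> nkw.
have Gxy : x * y \in G by apply: groupM.
apply: (kerV_maxsub (b := y)) => //.
  apply: index_maxsub index_lcn2_pres Gxy _ _; last first.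
    by rewrite xy2 lcn2_pres groupX.
  apply: contra (x_notin_y) => L2xy.
  rewrite -(mulgK y x) groupM ?groupV ?cycle_id //.
  by apply: subsetP L2xy; rewrite lcn2_pres cycle_subG mem_cycle.
rewrite transfer_index2_out ?maxsub_sub ?index_maxsub_x //; last first.
  rewrite inE Gxy andbT.
  apply: contra (notin_maxsub genG index_maxsub_x) => Mxy.
  by rewrite -(mulKg x y) groupM ?groupV ?mem_maxsub.
rewrite lcn2_maxsub_x xy2.
have [k1|k_neq1] := eqVneq k 1%N.
  rewrite z_k1 // addn0 ceven ?group1 //.
  by apply/negP => ow; apply: nkw.
apply: groupX; have k_gt1 : 1 < k by rewrite ltn_neqAle eq_sym k_neq1.
by rewrite -(subnKC k_gt1) expnD expgM mem_cycle.
Qed.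

(** The cyclic group <y> centralizes gamma_2(G). An element outside it is h x with h in <y>, and
    [hx, u] = [x, u] for u in gamma_2(G), so if it were in chi_2(G), x would be too. *)
Lemma chi2_pres : x \notin chi2 G -> maxsub G y = chi2 G :> {set gT}.
Proof.
move=> nXx; rewrite maxsub_y.
have comm_L2 g u : g \in <[y]> -> u \in 'L_2(G) -> [~ g, u] = 1.
  move=> yg L2u; apply/eqP/commgP/(centsP (cycle_abelian y)) => //.
  by apply: subsetP L2u; rewrite lcn2_pres cycle_subG mem_cycle.
have iy : #|G : <[y]>| = 2 by rewrite -index_maxsub_y maxsub_y.
apply/setP=> g; rewrite inE; apply/idP/andP=> [yg | [Gg /forall_inP Xg]].
  split; first by apply: subsetP yg; rewrite cycle_subG.
  by apply/forall_inP => u L2u; rewrite comm_L2.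
apply: contraR nXx => nyg; rewrite inE Gx; apply/forall_inP => u L2u.
have: g \in G :\: <[y]> by rewrite inE nyg.
rewrite -(rcoset_index2 _ iy (x := x)) ?cycle_subG ?inE ?x_notin_y //.
case/rcosetP=> h yh def_g; have := Xg u L2u.
by rewrite def_g commMgJ (comm_L2 h) // conj1g mul1g.
Qed.

(** * Identification with the dihedral, quaternion and semidihedral groups *)

Let joinG : <[y]> <*> <[x]> = G.
Proof. by rewrite joing_idl joing_idr /joing setUC genG. Qed.

(** The defining relations make G an image of the dihedral group, and the orders agree. The witness
    is (y, x) since the cyclic generator comes first. The other two types are treated alike. *)
Lemma isog_dihedral : ~~ odd w -> ~~ odd z -> G \isog 'D_(2 ^ k.+2).
Proof.
move=> ew ez; rewrite isogEcard oG card_2dihedral // leqnn andbT.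
rewrite Grp_2dihedral //; apply/existsP; exists (y, x) => /=.
by rewrite joinG x2 yx !ceven // -oy expg_order mulg1 !eqxx.
Qed.

Lemma isog_quaternion : odd w -> ~~ odd z -> G \isog 'Q_(2 ^ k.+2).
Proof.
move=> ow ez; rewrite isogEcard oG card_quaternion // leqnn andbT.
rewrite Grp_quaternion //; apply/existsP; exists (y, x) => /=.
rewrite joinG x2 yx [c ^+ z]ceven // -oy expg_order mulg1.
by rewrite codd // !eqxx.
Qed.

Lemma isog_semidihedral : 1 < k -> ~~ odd w -> odd z ->
  G \isog 'SD_(2 ^ k.+2).
Proof.
move=> k_gt1 ew oz; rewrite isogEcard oG card_semidihedral // leqnn andbT.
rewrite Grp_semidihedral //; apply/existsP; exists (y, x) => /=.
rewrite joinG x2 ceven // -oy expg_order yx [c ^+ z]codd //.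
(* The semidihedral relation is y^x = y^(2^k - 1), which is y^-1 c. *)
have -> : c = y * y ^+ (2 ^ k).-1 by rewrite -expgS prednK ?expn_gt0.
by rewrite mulKg !eqxx.
Qed.

End Presentation.

(** * From maximal class and the two relations to the cyclic subgroup *)

Section FromRelations.

Variables (gT : finGroupType) (G : {group gT}).
Implicit Types x y u : gT.

Lemma s_in_lcn x y j : x \in G -> y \in G -> s x y j.+2 \in 'L_j.+2(G).
Proof.
move=> Gx Gy; rewrite /s subn2 /=.
elim: j => [|j IHj]; first exact: mem_commg.
by rewrite iterS lcnSn mem_commg.
Qed.

(** The iterated inverse encodes u^((-1)^j): each commutation with x sends a power v of u to v^-2,
    which doubles the exponent and flips its sign. *)
Lemma conj_iter_invg u x j : u ^ x = u^-1 ->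
  (iter j invg u) ^ x = (iter j invg u)^-1.
Proof. by move=> ux; elim: j => //= j IHj; rewrite conjVg IHj. Qed.

Lemma iter_commg_inverted u x j : u ^ x = u^-1 ->
  iter j (fun v => [~ v, x]) u = (iter j invg u) ^+ (2 ^ j).
Proof.
move=> ux; elim: j => [|j IHj]; first by rewrite expg1.
rewrite iterS IHj commgEl conjXg conj_iter_invg // -expgVn -expgD.
by rewrite addnn -mul2n -expnS.
Qed.

Variables (k w z : nat) (x y : gT).
Hypotheses (k_gt0 : 0 < k) (z_k1 : k = 1%N -> z = 0%N).
Hypotheses (oG : #|G| = (2 ^ k.+2)%N) (nilG : nil_class G = k.+1).
Hypotheses (Gx : x \in G) (Gy : y \in G) (genG : G :=: <<[set x; y]>>).
Hypothesis rel_x : x ^+ 2 = s x y k.+1 ^+ w.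
Hypothesis rel_y : y ^+ 2 * s x y 2 = s x y k.+1 ^+ z.

Local Notation c := (s x y k.+1).
Local Notation u := (s x y 2).

Let c_central g : g \in G -> commute c g.
Proof.
move=> Gg; apply/commgP.
have nG : nilpotent G by apply: (@pgroup_nil _ 2); rewrite /pgroup oG pnatX.
have L1 : 'L_k.+2(G) = 1 by apply/(lcn_nil_classP _ nG); rewrite nilG.
have: [~ c, g] \in 'L_k.+2(G).
  (* Since k >= 1, the index k + 1 is at least 2, where [s] has its proper meaning. *)
  by rewrite -(prednK k_gt0) lcnSn mem_commg // s_in_lcn.
by rewrite L1 inE.
Qed.

Let uE : u = (y ^+ 2)^-1 * c ^+ z.
Proof. by rewrite -rel_y mulKg. Qed.

Lemma conj_rel : y ^ x = y^-1 * c ^+ z.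
Proof. by rewrite -rel_y expgS expg1 -(mulgA y) mulKg conjg_mulR. Qed.

Lemma commg_y_s2 : [~ y, u] = 1.
Proof.
apply/eqP/commgP; rewrite uE.
apply: commuteM; first exact/commuteV/commuteX.
exact/commuteX/commute_sym/c_central.
Qed.

(** That c^2 = 1 is still unknown here and will follow from this. Both sides are y^2 c^-z, by
    centrality of c alone. *)
Let ux : u ^ x = u^-1.
Proof.
have yc : commute y^-1 (c ^+ z).
  exact/commuteX/commute_sym/commuteV/c_central.
have cx : c ^ x = c by apply/conjg_fixP/commgP/c_central.
rewrite uE conjMg conjVg !conjXg cx conj_rel expgMn // expgVn.
rewrite [RHS]invMg [X in X * _]invMg !invgK.
have y2c : y ^+ 2 * c ^+ z = c ^+ z * y ^+ 2.
  exact/commuteX/commute_sym/commuteX/c_central.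
by rewrite -mulgA y2c [(c ^+ z) ^+ 2]expgS expg1 invMg -mulgA mulKg.
Qed.

Let cE : c = (iter k.-1 invg u) ^+ (2 ^ k.-1).
Proof.
by rewrite -(iter_commg_inverted k.-1 ux) -{1}(prednK k_gt0) /s subn2.
Qed.

(** Being a power of u or u^-1, c is inverted by x; being central, it is fixed by x. *)
Let c2 : c ^+ 2 = 1.
Proof.
have cx : c ^ x = c by apply/conjg_fixP/commgP/c_central.
have: c ^ x = c^-1 by rewrite cE conjXg conj_iter_invg // expgVn.
by rewrite cx expgS expg1 => {2}->; rewrite mulgV.
Qed.

(** The sign in c = u^(2^(k-1)) up to inversion is immaterial as c = c^-1. Inserting u = y^-2 c^z
    leaves the factor c^(z 2^(k-1)), trivial by parity for k > 1 and by z = 0 for k = 1. *)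
Lemma s_last : c = y ^+ (2 ^ k).
Proof.
have cV : c^-1 = c by apply/eqP; rewrite eq_invg_mul -c2.
have cu : c = u ^+ (2 ^ k.-1).
  have uV i : iter i invg u = u \/ iter i invg u = u^-1.
    elim: i => [|i /= [->|->]]; by [left | right | left; rewrite invgK].
  by case: (uV k.-1) cE => -> // cuV; rewrite -cV cuV expgVn invgK.
have d1 : (c ^+ z) ^+ (2 ^ k.-1) = 1.
  have [k1|k_neq1] := eqVneq k 1%N; first by rewrite z_k1 // expg0 expg1n.
  have k1_gt0 : 0 < k.-1 by rewrite -subn1 subn_gt0 ltn_neqAle eq_sym k_neq1.
  by rewrite -(prednK k1_gt0) expnS -expgM mulnCA expgM c2 expg1n.
rewrite -cV cu uE expgMn.
  by rewrite d1 mulg1 expgVn invgK -expgM -expnS prednK.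
exact/commuteX/commute_sym/commuteV/commuteX/c_central.
Qed.

(** Only the order of y remains. It divides 2^(k+1) since c^2 = 1; and G / <y> is generated by the
    image of x, whose square is trivial, so the index of <y> divides 2. *)
Lemma pres_of_relations : cyclic_index2_pres G k w z x y.
Proof.
split=> //; rewrite -?s_last ?conj_rel //.
have oy_dvd : #[y] %| 2 ^ k.+1.
  by rewrite order_dvdn expnSr expgM -s_last c2.
apply/eqP; rewrite eqn_dvd oy_dvd /=.
have nyx : <[x]> \subset 'N(<[y]>).
  by rewrite norms_cycle conj_rel s_last groupM ?groupV ?groupX ?cycle_id.
have genG' : G :=: <[x]> <*> <[y]> by rewrite joing_idl joing_idr genG.
have nyG : G \subset 'N(<[y]>) by rewrite genG' join_subG nyx normG.
have : #|G / <[y]>| %| 2.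
  rewrite genG' quotientYidr // quotient_cycle -?cycle_subG // order_dvdn.
  rewrite -morphX -?cycle_subG //= coset_id // rel_x s_last.
  by rewrite !groupX ?cycle_id.
rewrite card_quotient // -(@dvdn_pmul2l #[y]) ?order_gt0 //.
by rewrite Lagrange ?cycle_subG // oG expnSr dvdn_pmul2r.
Qed.

End FromRelations.

(** * Distinctness of the candidates for a kernel *)

Section Singulets.

Variables (gT : finGroupType) (G : {group gT}) (x y : gT).
Hypotheses (Gx : x \in G) (Gy : y \in G) (genG : G :=: <<[set x; y]>>).
Hypotheses (i1 : #|G : maxsub G y| = 2) (i2 : #|G : maxsub G x| = 2).
Hypothesis (i3 : #|G : maxsub G (x * y)| = 2).

Local Notation M1 := (maxsub G y).
Local Notation M2 := (maxsub G x).
Local Notation M3 := (maxsub G (x * y)).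

Let Gxy : x * y \in G. Proof. exact: groupM. Qed.

Let neq12 : (M1 / 'L_2(G) == M2 / 'L_2(G)) = false.
Proof. by apply: maxsub_quo_neq => //; rewrite setUC. Qed.

Let neq13 : (M1 / 'L_2(G) == M3 / 'L_2(G)) = false.
Proof.
apply: maxsub_quo_neq => //; apply/eqP; rewrite eqEsubset {1}genG.
rewrite !gen_subG !subUset !sub1set Gxy Gy !andbT -{1}(mulgK y x).
by rewrite groupM ?groupV ?mem_gen ?set21 ?set22.
Qed.

Let neq23 : (M2 / 'L_2(G) == M3 / 'L_2(G)) = false.
Proof.
apply: maxsub_quo_neq => //; apply/eqP; rewrite eqEsubset {1}genG.
rewrite !gen_subG !subUset !sub1set Gxy Gx !andbT -{2}(mulKg x y).
by rewrite groupM ?groupV ?mem_gen ?set21 ?set22.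
Qed.

(** [index] returns the first match, so all earlier entries of the list have to be ruled out. *)
Let quotient_neqs :=
  (neq12, neq13, neq23, maxsub_quo_neqG Gx i2, maxsub_quo_neqG Gy i1,
   maxsub_quo_neqG Gxy i3).

Lemma singulet0 : singulet M1 M2 M3 (G / 'L_2(G)) = 0%N.
Proof. by rewrite /singulet /= eqxx. Qed.

Lemma singulet1 : singulet M1 M2 M3 (M1 / 'L_2(G)) = 1%N.
Proof. by rewrite /singulet /= quotient_neqs eqxx. Qed.

Lemma singulet2 : singulet M1 M2 M3 (M2 / 'L_2(G)) = 2%N.
Proof. by rewrite /singulet /= !quotient_neqs eqxx. Qed.

Lemma singulet3 : singulet M1 M2 M3 (M3 / 'L_2(G)) = 3%N.
Proof. by rewrite /singulet /= !quotient_neqs eqxx. Qed.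

End Singulets.

(** * Assembly of the case distinctions *)

Theorem theorem2p6 (gT : finGroupType) (G : {group gT}) (m : nat) (x y : gT)
    (w z : nat)
    (m_ge3 : (3 <= m)%N)
    (oG : #|G| = (2 ^ m)%N)
    (metabelianG : abelian 'L_2(G))
    (maximal_classG : nil_class G = m.-1)
    (Gx : x \in G) (Gy : y \in G)
    (genG : G :=: <<[set x; y]>>)
    (x_notin_chi2 : (4 <= m)%N -> x \notin chi2 G)
    (y_in_chi2 : y \in chi2 G :\: 'L_2(G))
    (w_le1 : (w <= 1)%N) (z_le1 : (z <= 1)%N)
    (* z = 1 belongs to the representative G_0^(m)(1,0), which requires m >= 4;
       for m = 3, z = 1 the clauses "otherwise" below would be false *)
    (z_m3 : m = 3%N -> z = 0%N)
    (rel_x : x ^+ 2 = s x y m.-1 ^+ w)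
    (rel_y : y ^+ 2 * s x y 2 = s x y m.-1 ^+ z) :
  let M1 := maxsub G y in
  let M2 := maxsub G x in
  let M3 := maxsub G (x * y) in
  let K1 := kerV G M1 in
  let K2 := kerV G M2 in
  let K3 := kerV G M3 in
  let kappa1 := singulet M1 M2 M3 K1 in
  let kappa2 := singulet M1 M2 M3 K2 in
  let kappa3 := singulet M1 M2 M3 K3 in
  let nu := total_transfers [:: K1; K2; K3] in
  let G_is_D := G0_relations m 0 0 x y /\ G \isog 'D_(2 ^ m) in
  let G_is_Q := G0_relations m 0 1 x y /\ G \isog 'Q_(2 ^ m) in
  let G_is_S := G0_relations m 1 0 x y /\ G \isog 'SD_(2 ^ m) in
  [/\ (4 <= m)%N -> M1 :=: chi2 G,
      (* (1) *)
      [/\ [/\ w = 0%N -> z = 0%N -> K1 = G / 'L_2(G),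
              w = 1%N -> z = 0%N -> K1 = M1 / 'L_2(G)
            & (4 <= m)%N -> w = 0%N -> z = 1%N -> K1 = M2 / 'L_2(G)],
          (m = 3%N /\ w = 1%N /\ z = 0%N -> K2 = M2 / 'L_2(G)) /\
          (~ (m = 3%N /\ w = 1%N /\ z = 0%N) -> K2 = M3 / 'L_2(G))
        & (m = 3%N /\ w = 1%N /\ z = 0%N -> K3 = M3 / 'L_2(G)) /\
          (~ (m = 3%N /\ w = 1%N /\ z = 0%N) -> K3 = M2 / 'L_2(G))],
      (* (2) *)
      [/\ [/\ w = 0%N -> z = 0%N -> G_is_D /\ kappa1 = 0%N,
              w = 1%N -> z = 0%N -> G_is_Q /\ kappa1 = 1%N
            & (4 <= m)%N -> w = 0%N -> z = 1%N -> G_is_S /\ kappa1 = 2%N],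
          (m = 3%N /\ w = 1%N /\ z = 0%N -> G_is_Q /\ kappa2 = 2%N) /\
          (~ (m = 3%N /\ w = 1%N /\ z = 0%N) -> kappa2 = 3%N)
        & (m = 3%N /\ w = 1%N /\ z = 0%N -> G_is_Q /\ kappa3 = 3%N) /\
          (~ (m = 3%N /\ w = 1%N /\ z = 0%N) -> kappa3 = 2%N)]
    & (* (3) *)
      [/\ m = 3%N -> w = 1%N -> z = 0%N ->
            [/\ G_is_Q, (kappa1, kappa2, kappa3) = (1, 2, 3)%N & nu = 0%N],
          w = 0%N -> z = 0%N ->
            [/\ G_is_D, (kappa1, kappa2, kappa3) = (0, 3, 2)%N & nu = 1%N],
          (4 <= m)%N -> w = 1%N -> z = 0%N ->
            [/\ G_is_Q, (kappa1, kappa2, kappa3) = (1, 3, 2)%N & nu = 0%N]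
        & (4 <= m)%N -> w = 0%N -> z = 1%N ->
            [/\ G_is_S, (kappa1, kappa2, kappa3) = (2, 3, 2)%N & nu = 0%N]]].
Proof.
case: m m_ge3 oG maximal_classG x_notin_chi2 z_m3 rel_x rel_y => [|[|k]] //.
move=> k_gt0 oG' nilG x_chi z_m3' rel_x' rel_y' M1 M2 M3 K1 K2 K3.
have {}k_gt0 : (0 < k)%N by [].
have z_k1 : k = 1%N -> z = 0%N by move=> k1; apply: z_m3'; rewrite k1.
have P := pres_of_relations k_gt0 z_k1 oG' nilG Gx Gy genG rel_x' rel_y'.
have P' := pres_mulr P.
have ys2 : [~ y, s x y 2] = 1.
  exact: (commg_y_s2 k_gt0 oG' nilG Gx Gy rel_y').
have i1 : #|G : M1| = 2 := index_maxsub_y k_gt0 z_k1 P.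
have i2 : #|G : M2| = 2 := index_maxsub_x k_gt0 z_k1 P.
have i3 : #|G : M3| = 2 := index_maxsub_x k_gt0 z_k1 P'.
(* For the pair (xy, y) the subgroup playing the role of M_3 is generated by x y^2 and gamma_2(G),
   which is M_2 again. *)
have M2E : maxsub G (x * y * y) = M2.
  by rewrite -mulgA maxsub_mulr // (lcn2_pres k_gt0 z_k1 P) cycle_id.
have w01 : w = 0%N \/ w = 1%N by case: (w) w_le1 => [|[|]]; auto.
have odd_w : odd w -> w = 1%N by case: w01 => ->.
have K1_D : w = 0%N -> z = 0%N -> K1 = G / 'L_2(G).
  by move=> w0 z0; apply: (kerV_y_full k_gt0 z_k1 P); rewrite ?w0 ?z0.
have K1_Q : w = 1%N -> z = 0%N -> K1 = M1 / 'L_2(G).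
  by move=> w1 z0; apply: (kerV_y_y k_gt0 z_k1 P); rewrite ?w1 ?z0.
have K1_S : (4 <= k.+2)%N -> w = 0%N -> z = 1%N -> K1 = M2 / 'L_2(G).
  by move=> _ w0 z1; apply: (kerV_y_x k_gt0 z_k1 P); rewrite ?w0 ?z1.
have K2_Q8 : k.+2 = 3%N /\ w = 1%N /\ z = 0%N -> K2 = M2 / 'L_2(G).
  by case=> [[k1]] [w1 z0]; apply: (kerV_x_x k_gt0 z_k1 P); rewrite ?w1.
have K3_Q8 : k.+2 = 3%N /\ w = 1%N /\ z = 0%N -> K3 = M3 / 'L_2(G).
  by case=> [[k1]] [w1 z0]; apply: (kerV_x_x k_gt0 z_k1 P'); rewrite ?w1 ?z0.
have K2_gen : ~ (k.+2 = 3%N /\ w = 1%N /\ z = 0%N) -> K2 = M3 / 'L_2(G).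
  move=> nQ8; apply: (kerV_x_xy k_gt0 z_k1 P) => -[k1 /odd_w w1].
  by apply: nQ8; rewrite w1 z_k1 ?k1.
have K3_gen : ~ (k.+2 = 3%N /\ w = 1%N /\ z = 0%N) -> K3 = M2 / 'L_2(G).
  move=> nQ8; rewrite -M2E; apply: (kerV_x_xy k_gt0 z_k1 P') => -[k1].
  by rewrite (z_k1 k1) addn0 => /odd_w w1; apply: nQ8; rewrite w1 z_k1 ?k1.
have isD : w = 0%N -> z = 0%N ->
    G0_relations k.+2 0 0 x y /\ G \isog 'D_(2 ^ k.+2).
  move=> w0 z0; split; last by apply: (isog_dihedral P); rewrite ?w0 ?z0.
  by split; rewrite // ?rel_x' ?rel_y' ?w0 ?z0.
have isQ : w = 1%N -> z = 0%N ->
    G0_relations k.+2 0 1 x y /\ G \isog 'Q_(2 ^ k.+2).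
  move=> w1 z0.
  split; last by apply: (isog_quaternion k_gt0 P); rewrite ?w1 ?z0.
  by split; rewrite // ?rel_x' ?rel_y' ?w1 ?z0.
have isS : (4 <= k.+2)%N -> w = 0%N -> z = 1%N ->
    G0_relations k.+2 1 0 x y /\ G \isog 'SD_(2 ^ k.+2).
  move=> k_gt1 w0 z1.
  split; last by apply: (isog_semidihedral P); rewrite ?w0 ?z1.
  by split; rewrite // ?rel_x' ?rel_y' ?w0 ?z1.
have sing0 : singulet M1 M2 M3 (G / 'L_2(G)) = 0%N := singulet0 _ _ _.
have sing1 : singulet M1 M2 M3 (M1 / 'L_2(G)) = 1%N by apply: singulet1.
have sing2 : singulet M1 M2 M3 (M2 / 'L_2(G)) = 2%N by apply: singulet2.
have sing3 : singulet M1 M2 M3 (M3 / 'L_2(G)) = 3%N by apply: singulet3.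
have nG1 := maxsub_quo_neqG Gy i1.
have nG2 := maxsub_quo_neqG Gx i2.
have nG3 := maxsub_quo_neqG (groupM Gx Gy) i3.
pose Q8 := k.+2 = 3%N /\ w = 1%N /\ z = 0%N.
have Q8_dec : Q8 \/ ~ Q8.
  have [k1|/eqP k1] := eqVneq k.+2 3%N; last by right=> -[].
  case: w01 => [w0|w1]; first by right=> -[_ []]; rewrite w0.
  by left; split=> //; split=> //; apply: z_m3'.
move=> kappa1 kappa2 kappa3 nu G_is_D G_is_Q G_is_S.
(* Neither V_2 nor V_3 is ever total, so only V_1 can contribute to nu. *)
have nuE : nu = (K1 == G / 'L_2(G)) :> nat.
  rewrite /nu /total_transfers /= addn0.
  have [q|nq] := Q8_dec.
    by rewrite (K2_Q8 q) (K3_Q8 q) ![maxsub _ _ / _ == _]eq_sym nG2 nG3 addn0.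
  rewrite (K2_gen nq) (K3_gen nq) ![maxsub _ _ / _ == _]eq_sym nG2 nG3 addn0.
  by [].
have notQ8_k : (4 <= k.+2)%N -> ~ Q8 by move=> + [e]; rewrite e.
have notQ8_w : w = 0%N -> ~ Q8 by move=> w0 [_ []]; rewrite w0.
have k1_D : w = 0%N -> z = 0%N -> kappa1 = 0%N.
  by move=> w0 z0; rewrite /kappa1 K1_D.
have k1_Q : w = 1%N -> z = 0%N -> kappa1 = 1%N.
  by move=> w1 z0; rewrite /kappa1 K1_Q.
have k1_S : (4 <= k.+2)%N -> w = 0%N -> z = 1%N -> kappa1 = 2%N.
  by move=> m4 w0 z1; rewrite /kappa1 K1_S.
have k2_Q8 : Q8 -> kappa2 = 2%N by move=> q; rewrite /kappa2 K2_Q8.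
have k3_Q8 : Q8 -> kappa3 = 3%N by move=> q; rewrite /kappa3 K3_Q8.
have k2_gen : ~ Q8 -> kappa2 = 3%N by move=> nq; rewrite /kappa2 K2_gen.
have k3_gen : ~ Q8 -> kappa3 = 2%N by move=> nq; rewrite /kappa3 K3_gen.
split.
- by move=> m4; apply: (chi2_pres k_gt0 z_k1 P); apply: x_chi.
- by split.
- have Q8_isQ : Q8 -> G_is_Q by case=> _ []; apply: isQ.
  split; [split=> [w0 z0|w1 z0|m4 w0 z1] | split=> // q | split=> // q]; split.
  + exact: isD.
  + exact: k1_D.
  + exact: isQ.
  + exact: k1_Q.
  + exact: isS.
  + exact: k1_S.
  + exact: Q8_isQ.
  + exact: k2_Q8.
  + exact: Q8_isQ.
  exact: k3_Q8.
- split=> [m3 w1 z0|w0 z0|m4 w1 z0|m4 w0 z1]; split.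
  + exact: isQ.
  + by rewrite k1_Q // k2_Q8 // k3_Q8.
  + by rewrite nuE K1_Q // eq_sym nG1.
  + exact: isD.
  + by rewrite k1_D // k2_gen ?k3_gen; auto.
  + by rewrite nuE K1_D // eqxx.
  + exact: isQ.
  + by rewrite k1_Q // k2_gen ?k3_gen; auto.
  + by rewrite nuE K1_Q // eq_sym nG1.
  + exact: isS.
  + by rewrite k1_S // k2_gen ?k3_gen; auto.
  + by rewrite nuE K1_S // eq_sym nG2.
Qed.
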